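(* Let $(X,d)$ be a complete metric space, let $\psi\colon[0,1]\to[0,\infty]$ be an increasing function that vanishes with continuity at zero, and let $\Lambda\ge 0$, $\alpha\ge 1$ and $\beta\ge 0$ be fixed constants. Let $m\in\mathbb{N}$, $m\ge 1$, let $A_1,\ldots,A_m$ be non-empty closed subsets of $X$, put $Y=\bigcup_{i=1}^m A_i$ and $A_{m+1}=A_1$, and let $T\colon Y\to Y$ be a map such that $\bigcup_{i=1}^m A_i$ is a cyclic representation of $Y$ with respect to $T$. Fix an arbitrarily chosen $x_1\in Y$ and write $\|x\|:=d(x,x_1)$ for all $x\in Y$. Suppose that $$d(Tx,Ty)\le \frac{1-\varepsilon}{2}\,[d(x,Tx)+d(y,Ty)]+\Lambda\varepsilon^{\alpha}\psi(\varepsilon)\,[1+\|x\|+\|Tx\|+\|y\|+\|Ty\|]^{\beta}$$ for every $\varepsilon\in[0,1]$, every $i\in\{1,\ldots,m\}$, and all $x\in A_i$, $y\in A_{i+1}$. Then $T$ has a unique fixed point $x^*\in\bigcap_{i=1}^m A_i$.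
   Context: $\bigcup_{i=1}^m A_i$ (with each $A_i$ a non-empty subset of $Y$) is a cyclic representation of $Y$ with respect to $T\colon Y\to Y$ iff (1) $Y=\bigcup_{i=1}^m A_i$, and (2) $T(A_i)\subset A_{i+1}$ for $1\le i\le m-1$ and $T(A_m)\subset A_1$. ''$\psi$ vanishes with continuity at zero'' means $\psi(0)=0$ and $\psi$ is continuous at $0$, i.e. $\psi(\varepsilon)\to 0$ as $\varepsilon\to 0^+$. *)

(* Defs.v *)
(* MathComp-Analysis *)
From HB Require Import structures.
From mathcomp Require Import all_boot all_order all_algebra.
From mathcomp Require Import all_classical all_reals all_analysis.

Set Implicit Arguments.
Unset Strict Implicit.
Unset Printing Implicit Defensive.

Import Order.TTheory GRing.Theory Num.Theory.
Import numFieldNormedType.Exports.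

Local Open Scope classical_set_scope.
Local Open Scope ring_scope.

(* The library's [completeType] is pointed, so these spaces are non-empty. *)
#[short(type="completeMetricType")]
HB.structure Definition CompleteMetric (R : numDomainType) :=
  {X of Complete X & Metric R X}.

(* The index set is {0, ..., m-1}, and [ordS i] is i + 1 modulo m, so that the
   last set is mapped into the first one. *)
Definition cyclic_representation (X : Type) (m : nat) (A : 'I_m -> set X)
    (Y : set X) (T : X -> X) : Prop :=
  [/\ forall i, A i !=set0,
      Y = \bigcup_i A i
    & forall i, T @` A i `<=` A (ordS i)].

(* Only the values of [psi] on [0, 1] are involved: 0^'+ is the filter of right
   neighbourhoods of 0. *)
Definition vanishes_with_continuity_at_zero (R : realType)
    (psi : R -> \bar R) : Prop :=
  psi 0 = 0%E /\ psi eps @[eps --> 0^'+] --> 0%E.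

(* Main.v *)
Require Import Defs.
From HB Require Import structures.
From mathcomp Require Import all_boot all_order all_algebra.
From mathcomp Require Import all_classical all_reals all_analysis.
From mathcomp Require Import ring lra.

(** The parameter e gives two different pieces of information.

    At e = 0 the perturbation disappears and T is a cyclic Kannan map:
    d(Tx, Ty) <= (d(x, Tx) + d(y, Ty)) / 2 for x, y in consecutive sets.  Along
    the orbit u_n = T^n x1 this makes the steps d(u_n, u_{n+1}) nonincreasing.
    It also controls distant iterates.  Within any m consecutive indices after
    k the orbit visits the set that follows the one of u_n, so the Kannan
    inequality applies to u_n and some u_l with k <= l <= k + m, and walking
    from u_k to u_l costs at most m steps.  Hence, for k <= n,
    d(u_{k+1}, u_{n+1}) <= (m + 1) d(u_k, u_{k+1}) ([orbit_tail]).  With k = 0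
    this says that the orbit is bounded ([orbit_bounded]); and if the steps
    tend to 0 it says that the orbit is Cauchy.

    The Kannan constants 1/2 + 1/2 = 1 alone do not make the steps tend to 0;
    small positive e does.  As the orbit is bounded, the perturbation along it
    is at most K e psi(e) for a fixed K, because e^alpha <= e.  If the steps
    decrease to r, then r <= (1 - e) r + K e psi(e), that is, r <= K psi(e),
    and letting e tend to 0 gives r = 0 ([averaged_decay_cvg0]).

    The limit of the orbit lies in every A_i, since each of these closed sets is
    visited infinitely often, and the Kannan inequality at the limit makes it a
    fixed point ([cyclic_kannan_fixed_point]).  Any fixed point y in some A_i can
    be compared with it, as it lies in A_{i+1}; both displacements are 0, so the
    two points coincide ([kannan_fixed_point_unique]). *)

Set Implicit Arguments.
Unset Strict Implicit.
Unset Printing Implicit Defensive.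

Import Order.TTheory GRing.Theory Num.Theory.
Import numFieldNormedType.Exports.

Local Open Scope classical_set_scope.
Local Open Scope ring_scope.

Lemma val_iter_ordS (m : nat) (i : 'I_m) (n : nat) :
  iter n (@ordS m) i = ((i + n) %% m)%N :> nat.
Proof.
elim: n => [|n IHn] /=; first by rewrite addn0 modn_small.
by rewrite IHn -addn1 modnDml addn1 addnS.
Qed.

Lemma iter_ordS_window (m : nat) (i j : 'I_m) (k : nat) :
  exists2 l, (k <= l <= k + m)%N & iter l (@ordS m) i = j.
Proof.
have m_gt0 : (0 < m)%N by exact: leq_ltn_trans (ltn_ord i).
set a := iter k (@ordS m) i.
exists (k + (j + (m - a)) %% m)%N.
  by rewrite leq_addr leq_add2l ltnW// ltn_mod.
apply: val_inj => /=; rewrite addnC iterD -/a val_iter_ordS modnDmr.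
by rewrite addnCA subnKC 1?ltnW// modnDr modn_small.
Qed.

(** The factor e in the error term is what makes the conclusion possible: at the
    limit r of d the hypothesis reads r <= (1 - e) r + e eta, and e cancels. *)
Lemma averaged_decay_cvg0 (R : realType) (d : R^nat) :
  (forall n, 0 <= d n) -> nonincreasing_seq d ->
  (forall eta, 0 < eta -> exists2 e, 0 < e &
     forall n, d n.+1 <= (1 - e) / 2 * (d n + d n.+1) + e * eta) ->
  d @ \oo --> (0 : R).
Proof.
move=> d_ge0 d_decr decay.
have d_cvg : cvgn d.
  by apply: nonincreasing_is_cvgn => //; exists 0 => _ [n _ <-].
set r := limn d.
have d_r : d @ \oo --> r by [].
have dS_r : d n.+1 @[n --> \oo] --> r by move: d_r; rewrite -cvg_shiftS.
have r_ge0 : 0 <= r by apply: limr_ge => //; exact: nearW.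
suff r_le0 : r <= 0 by rewrite (_ : 0 = r)//; apply/eqP; rewrite eq_le r_ge0.
apply/ler_addgt0Pl => eta eta_gt0; rewrite addr0.
have [e e_gt0 e_decay] := decay _ eta_gt0.
have bound_cvg : (1 - e) / 2 * (d n + d n.+1) + e * eta @[n --> \oo] -->
    (1 - e) / 2 * (r + r) + e * eta.
  by apply: cvgD; [apply: cvgMr; exact: cvgD | exact: cvg_cst].
have : r <= (1 - e) / 2 * (r + r) + e * eta.
  by apply: (ler_cvg_to dS_r bound_cvg); exact: nearW.
by move=> r_le; rewrite -(ler_pM2l e_gt0); lra.
Qed.

Section CyclicKannan.
Context (R : realType) (X : metricType R) (m : nat).
Context (A : 'I_m -> set X) (T : X -> X).
Context (T_cyclic : forall i x, A i x -> A (ordS i) (T x)).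
Context (T_kannan : forall i x y, A i x -> A (ordS i) y ->
  mdist (T x) (T y) <= (mdist x (T x) + mdist y (T y)) / 2).

Lemma kannan_fixed_point_unique i x y :
  A i x -> A (ordS i) y -> T x = x -> T y = y -> x = y.
Proof.
move=> Ax Ay Tx Ty; have := T_kannan Ax Ay; rewrite Tx Ty !mdistxx addr0 mul0r.
by move=> xy; apply: mdist_positivity; apply/eqP; rewrite eq_le xy mdist_ge0.
Qed.

Context (i0 : 'I_m) (x0 : X) (A_x0 : A i0 x0).

Let u n := iter n T x0.
Let step n := mdist (u n) (u n.+1).

Lemma orbit_mem n : A (iter n (@ordS m) i0) (u n).
Proof. by elim: n => //= n; exact: T_cyclic. Qed.

(** Used both to find a partner for the Kannan inequality close to a given index
    and, letting k grow, to see every set visited infinitely often. *)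
Lemma orbit_visits (i : 'I_m) k : exists2 l, (k <= l <= k + m)%N & A i (u l).
Proof.
by have [l kl <-] := iter_ordS_window i0 i k; exists l => //; exact: orbit_mem.
Qed.

Lemma step_nonincreasing : nonincreasing_seq step.
Proof.
apply/nonincreasing_seqP => n.
have := T_kannan (orbit_mem n) (orbit_mem n.+1).
by rewrite -/(step n.+1) -/(step n) => stepS; lra.
Qed.

Lemma orbit_segment k j : mdist (u k) (u (k + j)) <= j%:R * step k.
Proof.
elim: j => [|j IHj]; first by rewrite addn0 mdistxx mul0r.
rewrite addnS (le_trans (metric_triangle _ (u (k + j)) _))//.
by rewrite mulrS mulrDl mul1r addrC lerD// step_nonincreasing// leq_addr.
Qed.

(** The triangle inequality through u_{l+1}, where l in [k, k + m] is such that
    u_l is in the set that follows the one of u_n: the Kannan inequality bounds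
    d(u_{n+1}, u_{l+1}) by the mean of steps n and l, at most step k, and at
    most m steps lead from u_{k+1} to u_{l+1}. *)
Lemma orbit_tail k n : (k <= n)%N ->
  mdist (u k.+1) (u n.+1) <= m.+1%:R * step k.
Proof.
move=> kn.
have [l /andP[kl lkm] A_ul] := orbit_visits (ordS (iter n (@ordS m) i0)) k.
have step_ge0 j : 0 <= step j by exact: mdist_ge0.
have kl_dist : mdist (u k.+1) (u l.+1) <= m%:R * step k.
  rewrite -(subnKC kl) -addSn (le_trans (orbit_segment _ _))//.
  by rewrite ler_pM// ?step_nonincreasing// ler_nat leq_subLR.
have nl_dist := T_kannan (orbit_mem n) A_ul.
rewrite -/(step n) -/(step l) in nl_dist.
have step_n := step_nonincreasing kn; have step_l := step_nonincreasing kl.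
have := metric_triangle (u k.+1) (u l.+1) (u n.+1).
rewrite (metric_sym (u l.+1)) mulrS mulrDl mul1r.
rewrite -[u n.+1]/(T (u n)) -[u l.+1]/(T (u l)) in kl_dist nl_dist *.
by move: kl_dist nl_dist step_n step_l; lra.
Qed.

Lemma orbit_bounded n : mdist (u n) x0 <= m.+2%:R * step 0.
Proof.
have step0_ge0 : 0 <= step 0 by exact: mdist_ge0.
case: n => [|n]; first by rewrite mdistxx mulr_ge0.
rewrite metric_sym (le_trans (metric_triangle _ (u 1) _))//.
by rewrite mulrS mulrDl mul1r lerD2l orbit_tail.
Qed.

End CyclicKannan.

(** Vanishing steps make the orbit Cauchy by [orbit_tail].  Its limit x lies in
    every A_i, hence in the set that follows the one of u_n whatever n is, so
    the Kannan inequality applies to u_n and x; in the limit it says that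
    d(x, Tx) <= d(x, Tx) / 2. *)
Lemma cyclic_kannan_fixed_point (R : realType) (X : completeMetricType R)
    (m : nat) (A : 'I_m -> set X) (T : X -> X) (i0 : 'I_m) (x0 : X) :
  (forall i, closed (A i)) ->
  (forall i x, A i x -> A (ordS i) (T x)) ->
  (forall i x y, A i x -> A (ordS i) y ->
    mdist (T x) (T y) <= (mdist x (T x) + mdist y (T y)) / 2) ->
  A i0 x0 ->
  mdist (iter n T x0) (iter n.+1 T x0) @[n --> \oo] --> (0 : R) ->
  exists2 x : X, (\bigcap_i A i) x & T x = x.
Proof.
move=> A_closed T_cyclic T_kannan A_x0 step_cvg0.
pose u n := iter n T x0.
pose step n := mdist (u n) (u n.+1).
have step_small (e : R) : 0 < e -> \forall n \near \oo, step n < e.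
  move=> e_gt0; exact: (cvgr_lt 0 step_cvg0).
have u_cauchy : cauchy (u @ \oo).
  apply: cauchy_exP => e e_gt0.
  have [|N _ step_N] := step_small (e / m.+1%:R); first by rewrite divr_gt0.
  exists (u N.+1); exists N.+1 => // -[//|n] /= Nn.
  rewrite ballEmdist /=.
  apply: (le_lt_trans (orbit_tail (k := N) (n := n) T_cyclic T_kannan A_x0 Nn)).
  by have := step_N N (leqnn N); rewrite /= ltr_pdivlMr// mulrC.
have /cauchy_cvgP/cvg_ex[x u_x] := u_cauchy.
have A_x i : A i x.
  apply: A_closed => B /u_x[N _ BN].
  have [l /andP[Nl _] A_ul] := orbit_visits T_cyclic A_x0 i N.
  by exists (u l); split => //; exact: BN.
exists x => [i _|]; first exact: A_x.
apply/esym/mdist_positivity/eqP; rewrite eq_le mdist_ge0 andbT.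
apply/ler_addgt0Pl => e e_gt0; rewrite addr0.
have e4_gt0 : 0 < e / 4 by lra.
(* The bound d(x, Tx) <= d(x, u_{n+1}) + (d(u_n, u_{n+1}) + d(x, Tx)) / 2 makes
   it enough to have both terms in u smaller than e / 4. *)
have [N _ uS_x] : \forall n \near \oo, mdist x (u n) < e / 4.
  have /u_x : nbhs x (ball x (e / 4)) by exact: nbhsx_ballx.
  by rewrite ballEmdist.
have [N' _ stepN'] := step_small _ e4_gt0.
pose n := maxn N N'.
have xu := uS_x n.+1 (leqW (leq_maxl _ _)).
have un := stepN' n (leq_maxr _ _).
have uTx := T_kannan _ _ _ (orbit_mem T_cyclic A_x0 n) (A_x _).
have := metric_triangle x (u n.+1) (T x).
rewrite /step /= in xu un uTx *.
by move: xu un uTx; rewrite -/(u n); lra.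
Qed.

Theorem theorem3 (R : realType) (X : completeMetricType R)
    (psi : R -> \bar R)
    (psi_ge0 : forall e : R, 0 <= e <= 1 -> (0 <= psi e)%E)
    (psi_incr : forall e1 e2 : R,
      0 <= e1 -> e1 <= e2 -> e2 <= 1 -> (psi e1 <= psi e2)%E)
    (psi_zero : vanishes_with_continuity_at_zero psi)
    (Lambda alpha beta : R)
    (Lambda_ge0 : 0 <= Lambda) (alpha_ge1 : 1 <= alpha) (beta_ge0 : 0 <= beta)
    (m : nat) (m_ge1 : (1 <= m)%N)
    (A : 'I_m -> set X)
    (A_closed : forall i, closed (A i))
    (Y : set X) (T : {fun Y >-> Y})
    (cyclicT : cyclic_representation A Y T)
    (x1 : X) (Yx1 : Y x1)
    (contrT : forall (e : R) (i : 'I_m) (x y : X),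
      0 <= e <= 1 -> A i x -> A (ordS i) y ->
      ((mdist (T x) (T y))%:E <=
        ((1 - e) / 2 * (mdist x (T x) + mdist y (T y)))%:E
        + (Lambda * e `^ alpha)%:E * psi e
          * ((1 + mdist x x1 + mdist (T x) x1
                + mdist y x1 + mdist (T y) x1) `^ beta)%:E)%E) :
  exists xstar : X,
    [/\ (\bigcap_i A i) xstar,
        T xstar = xstar
      & forall y : X, Y y -> T y = y -> y = xstar].
Proof.
have [psi0 psi_cvg0] := psi_zero.
have [_ Y_def TA] := cyclicT.
have T_cyclic i x : A i x -> A (ordS i) (T x) by move=> Ax; apply: TA; exists x.
have T_kannan i x y : A i x -> A (ordS i) y ->
    mdist (T x) (T y) <= (mdist x (T x) + mdist y (T y)) / 2.
  move=> Ax Ay; have := contrT 0 i x y _ Ax Ay.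
  rewrite lexx ler01 psi0 mule0 mul0e adde0 lee_fin => /(_ isT).
  by rewrite subr0 mul1r mulrC.
have [i0 _ A_x1] : (\bigcup_i A i) x1 by rewrite -Y_def.
pose u n := iter n T x1.
pose step n := mdist (u n) (u n.+1).
have step_cvg0 : step @ \oo --> (0 : R).
  apply: averaged_decay_cvg0 => [n||eta eta_gt0]; first exact: mdist_ge0.
    exact: (step_nonincreasing T_cyclic T_kannan A_x1).
  (* M bounds the norms along the orbit, so that C bounds the factor raised to
     the power beta; delta is small enough for Lambda * C * delta <= eta. *)
  pose M := m.+2%:R * step 0.
  have u_bounded n : mdist (u n) x1 <= M.
    exact: (orbit_bounded T_cyclic T_kannan A_x1).
  pose C := (1 + 4 * M) `^ beta.
  have C_ge0 : 0 <= C by exact: powR_ge0.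
  pose delta := eta / (Lambda * C + 1).
  have LC_gt0 : 0 < Lambda * C + 1 by rewrite ltr_wpDl// mulr_ge0.
  have delta_gt0 : 0 < delta by rewrite divr_gt0.
  have psi_small : \forall e \near (0 : R)^'+, (psi e < delta%:E)%E.
    apply: (psi_cvg0 [set y | y < delta%:E]%E (open_ereal_lt' _)).
    by rewrite lte_fin.
  have [e [psi_e e_gt0 e_lt1]] :
      exists e : R, [/\ (psi e < delta%:E)%E, 0 < e & e < 1].
    apply: (@filter_ex _ (0 : R)^'+); near=> e; split; near: e => //.
      exact: nbhs_right_gt.
    exact: nbhs_right_lt.
  exists e => // n.
  have e01 : 0 <= e <= 1 by rewrite !ltW.
  have := contrT e _ _ _ e01 (orbit_mem T_cyclic A_x1 n)
    (orbit_mem T_cyclic A_x1 n.+1).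
  move=> /le_trans contr_n; rewrite -lee_fin EFinD; apply: contr_n.
  rewrite leeD2l//.
  (* psi may be infinite away from 0, but not where it is below delta. *)
  have [p psi_p] : exists p, psi e = p%:E.
    by move: (psi_ge0 _ e01) psi_e; case: (psi e) => [p| |]//; exists p.
  have p_ge0 : 0 <= p by move: (psi_ge0 _ e01); rewrite psi_p lee_fin.
  have p_lt : p < delta by move: psi_e; rewrite psi_p lte_fin.
  rewrite psi_p -!EFinM lee_fin.
  have powe : e `^ alpha <= e.
    rewrite -[leRHS]powRr1; last exact: ltW.
    by apply: ger_powR; rewrite // e_gt0 ltW.
  have powM : (1 + mdist (u n) x1 + mdist (u n.+1) x1 + mdist (u n.+1) x1
      + mdist (u n.+2) x1) `^ beta <= C.
    have d_ge0 j : 0 <= mdist (u j) x1 by exact: mdist_ge0.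
    have := (u_bounded n, u_bounded n.+1, u_bounded n.+2).
    have := (d_ge0 n, d_ge0 n.+1, d_ge0 n.+2).
    move=> [[? ?] ?] [[? ?] ?].
    by apply: ge0_ler_powR => //; rewrite ?nnegrE; lra.
  apply: (@le_trans _ _ (Lambda * e * delta * C)).
    by rewrite !ler_pM ?mulr_ge0 ?powR_ge0 ?(ltW p_lt).
  have <- : delta * (Lambda * C + 1) = eta by rewrite divfK ?gt_eqF.
  rewrite [leLHS](_ : _ = e * (delta * (Lambda * C))); last by ring.
  by rewrite !ler_pM2l ?lerDl.
have [x A_x Tx] :=
  cyclic_kannan_fixed_point A_closed T_cyclic T_kannan A_x1 step_cvg0.
exists x; split => // y Yy Ty.
have [i _ A_y] : (\bigcup_i A i) y by rewrite -Y_def.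
by apply: (kannan_fixed_point_unique T_kannan A_y _ Ty Tx); exact: A_x.
Unshelve. all: by end_near.
Qed.
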